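(* For any given integers $L\ge1$ and $K\ge1$ and any $\gamma>0$, let $\kappa:=n/p$. Then there are constants $A>0$ and $c_0>0$, depending on $K,L,\gamma,\sigma^2$ and $\kappa$, such that $$\inf_{\widehat M}\ \sup_{M\in\mathcal{M}(L,\gamma,K)}\mathbb{P}_M\left(\frac{1}{np}\|\widehat M-M\|_F^2>A\left(\frac{n\vee p}{N}\right)^{\frac{2L}{2L+K}}\right)\ge\frac12$$ whenever $$c_0^{-\frac{2L+K}{K}}(n\vee p)\le N\le c_0^{-\frac{2L+K}{K}}\,0.48^{2L+K}\,(n\vee p)\,n^{\frac{2L+K}{K}}.$$
   Context: $n,p,N$ are positive integers, $n\vee p=\max(n,p)$, $\langle A,B\rangle=\operatorname{tr}(A^TB)$, $\|\cdot\|_F$ is the Frobenius norm. $\mathcal{X}=\{e_n(i)e_p(j)^T:1\le i\le n,\ 1\le j\le p\}$, where $e_n(i)$ is the $i$-th standard basis vector of $\mathbb{R}^n$. For $M\in\mathbb{R}^{n\times p}$, $\mathbb{P}_M$ is the distribution of the observations $\{(y_t,X_t)\}_{t=1}^N$ where $X_t$ are i.i.d. uniform on $\mathcal{X}$ and $y_t=\langle X_t,M\rangle+\xi_t$ with $\xi_t$ i.i.d. $N(0,\sigma^2)$, $\sigma>0$, independent of the $X_t$. The infimum is over all estimators $\widehat M$, i.e. measurable functions of $\{(y_t,X_t)\}_{t=1}^N$ with values in $\mathbb{R}^{n\times p}$. $\mathcal{F}(L,\gamma,K)$ is the set of $L$-th order differentiable functions $f:[0,1]^K\to\mathbb{R}$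 with $\left|\frac{\partial^L f}{\partial x_1^{L_1}\cdots\partial x_K^{L_K}}(\mathbf{x}^0)\right|\le\gamma$ for all $\mathbf{x}^0\in[0,1]^K$ and all nonnegative integers $L_1,\dots,L_K$ with $L_1+\cdots+L_K=L$. $\mathcal{M}(L,\gamma,K)$ is the set of $M\in\mathbb{R}^{n\times p}$ with $m_{ij}=f_j(\theta_{i,\cdot})$ for some $f_1,\dots,f_p\in\mathcal{F}(L,\gamma,K)$ and $\theta_{1,\cdot},\dots,\theta_{n,\cdot}\in[0,1]^K$. *)

(* Defs.v *)
From HB Require Import structures.
From mathcomp Require Import all_boot all_order all_algebra.
From mathcomp Require Import all_classical all_reals all_analysis.
From mathcomp Require Import measurable_realfun.

Set Implicit Arguments.
Unset Strict Implicit.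
Unset Printing Implicit Defensive.

Import Order.TTheory GRing.Theory Num.Theory numFieldNormedType.Exports.

Local Open Scope classical_set_scope.
Local Open Scope ring_scope.

Section Matrices.
Variables (R : realType) (n p : nat).
Implicit Types A B : 'M[R]_(n, p).

Definition mxinner A B : R := \tr (A^T *m B).

Definition frob_norm A : R := Num.sqrt (\sum_(i < n) \sum_(j < p) A i j ^+ 2).

End Matrices.

(* R^(n x p) with its Borel sigma-algebra. *)
Definition borelM (R : realType) (n p : nat) :=
  g_sigma_algebraType (@open 'M[R]_(n, p)).

Section Smoothness.
Variables (R : realType) (K : nat).
Implicit Types (f : 'rV[R]_K -> R) (x : 'rV[R]_K).

Definition cube : set 'rV[R]_K := [set x | forall k, 0 <= x ord0 k <= 1].

(* A function on the cube is represented by a total function of which only the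
   values on the cube matter: all limits below are taken inside the cube, hence
   are one-sided on its boundary. *)

Definition cube_differentiable f x :=
  exists df : {linear 'rV[R]_K -> R^o}, forall eps : R, 0 < eps ->
    \forall y \near within cube (nbhs x),
      `|f y - f x - df (y - x)| <= eps * `|y - x|.

Definition cube_partial (k : 'I_K) f : 'rV[R]_K -> R := fun x =>
  let e := delta_mx ord0 k in
  lim ((fun h : R => h^-1 * (f (x + h *: e) - f x))
       @ within [set h | cube (x + h *: e)] 0^').

Fixpoint ntimes_differentiable (L : nat) f : Prop :=
  if L is L'.+1 then
    (forall x, cube x -> cube_differentiable f x) /\
    (forall k, ntimes_differentiable L' (cube_partial k f))
  else True.

(* d^(l 0 + ... + l (K-1)) f / dx_0^(l 0) ... dx_(K-1)^(l (K-1)) *)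
Definition cube_mixed_partial (l : 'I_K -> nat) f : 'rV[R]_K -> R :=
  foldr (fun k g => iter (l k) (cube_partial k) g) f (enum 'I_K).

Definition smooth_class (L : nat) (gamma : R) : set ('rV[R]_K -> R) :=
  [set f | ntimes_differentiable L f /\
    forall l : 'I_K -> nat, (\sum_(k < K) l k)%N = L ->
    forall x, cube x -> `|cube_mixed_partial l f x| <= gamma].

Definition matrix_class (n p L : nat) (gamma : R) : set 'M[R]_(n, p) :=
  [set M | exists (f : 'I_p -> 'rV[R]_K -> R) (theta : 'I_n -> 'rV[R]_K),
    [/\ forall j, smooth_class L gamma (f j),
        forall i, cube (theta i) &
        forall i j, M i j = f j (theta i)]].

End Smoothness.

Section ProductProbability.
Context d1 d2 (T1 : measurableType d1) (T2 : measurableType d2) (R : realType).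
Variables (P1 : probability T1 R) (P2 : probability T2 R).
Local Open Scope ereal_scope.

Definition prod_prob : set (T1 * T2) -> \bar R := P1 \x P2.

HB.instance Definition _ := Measure.on prod_prob.

Let prod_prob_setT : prod_prob [set: _] = 1.
Proof.
by rewrite -setXTT [LHS]product_measure1E// [X in X * _]probability_setT
  [X in _ * X]probability_setT mule1.
Qed.

HB.instance Definition _ :=
  Measure_isProbability.Build _ _ _ prod_prob prod_prob_setT.

End ProductProbability.

Section IidLaw.
Context d (T : measurableType d) (R : realType).

Definition tuple_cons n (x : T * n.-tuple T) : n.+1.-tuple T :=
  [tuple of x.1 :: x.2].

Let measurable_tuple_cons n : measurable_fun [set: _] (@tuple_cons n).
Proof. exact: measurable_cons. Qed.

HB.instance Definition _ n :=
  isMeasurableFun.Build _ _ _ _ (@tuple_cons n) (@measurable_tuple_cons n).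

(* The law of n independent variables with common law P. *)
Fixpoint iid_law (P : probability T R) (n : nat) : probability (n.-tuple T) R :=
  if n is n'.+1
  then distribution (prod_prob P (iid_law P n')) (@tuple_cons n')
  else \d_[tuple].

End IidLaw.

(* The uniform distribution on the matrices e_n(i) e_p(j)^T. The positivity
   proofs are used only for the instance of probability measure. *)
Definition uniform_design (R : realType) (n p : nat)
    of (0 < n)%N & (0 < p)%N : set (borelM R n p) -> \bar R :=
  fun A => (((n * p)%:R^-1)%:E *
    \sum_(ij : 'I_n * 'I_p) \d_(delta_mx ij.1 ij.2 : borelM R n p) A)%E.
Arguments uniform_design : clear implicits.
Arguments uniform_design R {n p}.

Section UniformDesign.
Variables (R : realType) (n p : nat).
Variables (n_gt0 : (0 < n)%N) (p_gt0 : (0 < p)%N).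
Local Open Scope ereal_scope.
Local Notation uniform_design := (uniform_design R n_gt0 p_gt0).

Let uniform_design0 : uniform_design set0 = 0.
Proof.
by rewrite /uniform_design big1 ?mule0// => ij _; rewrite measure0.
Qed.

Let uniform_design_ge0 A : 0 <= uniform_design A.
Proof. by rewrite mule_ge0 ?lee_fin// sume_ge0. Qed.

Let uniform_design_sigma_additive : semi_sigma_additive uniform_design.
Proof.
move=> F mF tF mUF.
rewrite [X in X @ _ --> _](_ : _ = fun k : nat => ((n * p)%:R^-1)%:E *
    \sum_(ij : 'I_n * 'I_p)
      \sum_(0 <= i < k) \d_(delta_mx ij.1 ij.2 : borelM R n p) (F i)).
  apply: cvgeZl => //; apply: cvg_nnesum => ij _.
    by apply: nearW => k; exact: sume_ge0.
  exact: measure_semi_sigma_additive.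
by apply/funext => k; rewrite exchange_big/= ge0_sume_distrr// => i _;
  exact: sume_ge0.
Qed.

HB.instance Definition _ := isMeasure.Build _ _ _ uniform_design
  uniform_design0 uniform_design_ge0 uniform_design_sigma_additive.

Let uniform_design_setT : uniform_design [set: _] = 1.
Proof.
rewrite /uniform_design; under eq_bigr do rewrite diracT.
rewrite sumEFin sumr_const card_prod !card_ord -EFinM mulVf//.
by rewrite pnatr_eq0 -lt0n muln_gt0 n_gt0 p_gt0.
Qed.

HB.instance Definition _ :=
  Measure_isProbability.Build _ _ _ uniform_design uniform_design_setT.

End UniformDesign.

Section Observations.
Variables (R : realType) (n p : nat).

Definition observe (M : 'M[R]_(n, p)) (z : borelM R n p * measurableTypeR R) :
  measurableTypeR R * borelM R n p := (mxinner z.1 M + z.2, z.1).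

Lemma measurable_coord (i : 'I_n) (j : 'I_p) :
  measurable_fun [set: borelM R n p] (fun X : borelM R n p => X i j).
Proof.
apply: (measurability _ (RGenOpens.measurableE R)) => _ [_ [a [b ->] <-]].
rewrite setTI; apply: sub_sigma_algebra; apply: open_comp => [X _|].
  exact: coord_continuous.
exact: interval_open.
Qed.

Lemma measurable_mxinner (M : 'M[R]_(n, p)) :
  measurable_fun [set: borelM R n p] (fun X : borelM R n p => mxinner X M).
Proof.
have -> : (fun X : borelM R n p => mxinner X M) =
    fun X => \sum_(j < p) \sum_(i < n) X i j * M i j.
  apply/funext => X; rewrite /mxinner /mxtrace; apply: eq_bigr => j _.
  by rewrite mxE; apply: eq_bigr => i _; rewrite mxE.
apply: measurable_sum => j; apply: measurable_sum => i.
apply: measurable_funM => //.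
exact: measurable_coord.
Qed.

Let measurable_observe M : measurable_fun [set: _] (observe M).
Proof.
apply/measurable_fun_pairP; split; last exact: measurable_fst.
apply: measurable_funD; last exact: measurable_snd.
exact: (measurableT_comp (measurable_mxinner M)).
Qed.

HB.instance Definition _ M :=
  isMeasurableFun.Build _ _ _ _ (observe M) (measurable_observe M).

Variables (n_gt0 : (0 < n)%N) (p_gt0 : (0 < p)%N).

Definition obs_law (sigma : R) (M : 'M[R]_(n, p)) :
    probability (measurableTypeR R * borelM R n p)%type R :=
  distribution (prod_prob (uniform_design R n_gt0 p_gt0)
    (normal_prob 0 sigma)) (observe M).

Definition sample_law (sigma : R) (M : 'M[R]_(n, p)) (N : nat) :
    probability (N.-tuple (measurableTypeR R * borelM R n p)%type) R :=
  iid_law (obs_law sigma M) N.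

End Observations.

(* Main.v *)
Require Import Defs.
From mathcomp Require Import all_boot all_order all_algebra.
From mathcomp Require Import all_classical all_reals all_analysis.
From mathcomp Require Import measurable_realfun.
From mathcomp Require Import ring lra zify.

Set Implicit Arguments.
Unset Strict Implicit.
Unset Printing Implicit Defensive.

Import Order.TTheory GRing.Theory Num.Theory numFieldNormedType.Exports.

Local Open Scope classical_set_scope.
Local Open Scope ring_scope.

(** The proof compares the risk of an estimator with the average number of
    hypotheses it can fit at once.

    Divide the cube into k^K cells of side 1/k, with k of the order of
    (N / max(n, p))^(1/(2L+K)), so that k^K <= n. Put the latent point of every
    row at the centre of a cell, sharing the rows evenly among the cells
    ([balanced_assignment]). A sum of disjointly supported bumps, one per cell,
    takes arbitrary values of size tau * k^-L at the centres and has its L-th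
    order derivatives bounded by a constant times tau ([grid_interpolation]).
    Hence every word w over the cells times the columns, with letters in
    {0, ..., 1023}, gives a matrix of the class: its entry (i, j) is delta times
    the letter of w at the cell of row i and column j, where
    delta = tau * k^-L ([word_mx]).

    Let D = k^K * p be the length of the words. The law P_w of the sample under
    the matrix of w satisfies

      (E_(P_w) f)^2 <= C * E_(P_0) f^2   for every measurable f in [0, 1],

    with C = exp(N (1024 delta)^2 / sigma^2) <= exp(D) once tau is small. This is
    how a bound on the second moment of the likelihood ratio dP_w/dP_0 is used;
    stated for functions ([chi2_dom]) it needs no density on the space of
    samples, it passes to products by integrating one variable at a time
    ([chi2_dom_prod_prob], [chi2_dom_iid_law]), and densities enter only for one
    Gaussian variable ([chi2_dom_normal_prob]).

    An estimate close to the matrices of both w and w' forces w and w' to differ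
    in at most half of their letters ([word_mx_separated]), and at most 64^D
    words are pairwise that close ([card_hamming_cluster]). So the events
    E_w that w is well estimated satisfy sum_w P_0(E_w) <= 64^D. Since
    x <= 1/4 + x^2, the average of P_w(E_w) over the 1024^D words is at most
    1/4 + 4^D * 64^D / 1024^D <= 1/2 ([chi2_testing]), and one of the words
    is badly estimated with probability at least 1/2.

    A large alphabet is used, rather than a packing of binary words, because D
    may be as small as 1: with two hypotheses only, any information lets a test
    err with probability less than 1/2 under both. *)

(** * Chi-square domination of probability measures *)

Section UnitValued.
Context d (T : measurableType d) (R : realType).
Implicit Types (P Q : probability T R) (f : T -> R).

Definition unit_valued f :=
  measurable_fun [set: T] f /\ forall x, 0 <= f x <= 1.

Lemma unit_valued_sqr f : unit_valued f -> unit_valued (fun x => f x ^+ 2).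
Proof.
move=> [mf f01]; split; first exact: measurable_funX.
by move=> x; have /andP[f0 f1] := f01 x; rewrite sqr_ge0 expr_le1.
Qed.

Lemma unit_valued_integrable P f :
  unit_valued f -> P.-integrable [set: T] (EFin \o f).
Proof.
move=> [mf f01]; apply: measurable_bounded_integrable => //.
  by rewrite [X in (X < _)%E]probability_setT ltry.
exists 1; split => // x x1 y _ /=; have /andP[f0 f1] := f01 y.
by rewrite ger0_norm// (le_trans f1)// ltW.
Qed.

Lemma unit_valued_EFin_Rintegral P f : unit_valued f ->
  (\int[P]_x f x)%:E = (\int[P]_x (f x)%:E)%E.
Proof.
move=> uf; rewrite /Rintegral fineK//.
exact: integrable_fin_num (unit_valued_integrable P uf).
Qed.

Lemma unit_valued_Rintegral P f : unit_valued f -> 0 <= \int[P]_x f x <= 1.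
Proof.
move=> uf; rewrite Rintegral_ge0 /=; last by move=> x _; case/andP: (uf.2 x).
have <- : \int[P]_x (cst 1 x) = 1 :> R.
  by rewrite Rintegral_cst// [X in fine X]probability_setT mulr1.
apply: le_Rintegral => //.
- exact: unit_valued_integrable.
- by apply: unit_valued_integrable; split => // x; rewrite lexx ler01.
- by move=> x _; case/andP: (uf.2 x).
Qed.

End UnitValued.

(** Optimizing the inequality between arithmetic and geometric means over its
    parameter gives a Cauchy-Schwarz inequality from pointwise bounds. *)
Lemma sqr_le_of_affine_bounds (R : realType) (I C Y : R) :
  0 < C -> 0 <= I -> 0 <= Y ->
  (forall a, 0 < a -> 2 * I <= a * Y + C / a) -> I ^+ 2 <= C * Y.
Proof.
move=> C0 I0 Y0 h; have [->|In0] := eqVneq I 0.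
  by rewrite expr2 mul0r mulr_ge0// ltW.
have Ip : 0 < I by rewrite lt_neqAle eq_sym In0.
have := h (C / I) (divr_gt0 C0 Ip).
rewrite invf_div mulrA [C * I]mulrC mulfK ?gt_eqF// => h1.
have h2 : I <= C / I * Y by lra.
rewrite expr2; apply: (le_trans (ler_wpM2r I0 h2)).
by rewrite mulrAC divfK.
Qed.

Section ChiSquareDomination.
Context (R : realType).

(** When P has a density l with respect to Q, the least such C is the integral of
    l^2 with respect to Q, by Cauchy-Schwarz and truncation; C - 1 is then the
    chi-square divergence of P from Q. *)
Definition chi2_dom d (T : measurableType d) (P Q : probability T R) (C : R) :=
  forall f, unit_valued f ->
    (\int[P]_x f x) ^+ 2 <= C * \int[Q]_x (f x ^+ 2).

(** Jensen's inequality for the square. *)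
Lemma chi2_dom_refl d (T : measurableType d) (P : probability T R) :
  chi2_dom P P 1.
Proof.
move=> f uf; have /andP[I0 _] := unit_valued_Rintegral P uf.
have /andP[Y0 _] := unit_valued_Rintegral P (unit_valued_sqr uf).
apply: (sqr_le_of_affine_bounds ltr01 I0 Y0) => a a0.
rewrite -RintegralZl ?unit_valued_integrable//.
rewrite -RintegralZl//; last exact: (unit_valued_integrable _ (unit_valued_sqr uf)).
have <- : \int[P]_x (cst (1 / a) x) = 1 / a :> R.
  by rewrite Rintegral_cst// [X in fine X]probability_setT mulr1.
have i1 : P.-integrable setT (EFin \o (fun x => a * f x ^+ 2)).
  have -> : (EFin \o (fun x => a * f x ^+ 2)) =
            (fun x => (a%:E * (EFin \o (fun x => f x ^+ 2)%R) x)%E).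
    by apply/funext => x /=; rewrite EFinM.
  apply: integrableZl => //.
  exact: (unit_valued_integrable _ (unit_valued_sqr uf)).
have i2 : P.-integrable setT (EFin \o cst (1 / a)).
  exact: finite_measure_integrable_cst.
rewrite -RintegralD//; apply: le_Rintegral => //.
- have -> : (EFin \o (fun x => 2 * f x)) =
            (fun x => (2%:E * (EFin \o f) x)%E).
    by apply/funext => x /=; rewrite EFinM.
  by apply: integrableZl => //; exact/unit_valued_integrable.
- have -> : (EFin \o (fun x => a * f x ^+ 2 + cst (1 / a) x)) =
     ((EFin \o (fun x => a * f x ^+ 2)%R) \+ (EFin \o cst (1 / a)%R))%E.
    by apply/funext => x /=; rewrite EFinD.
  exact: integrableD.
- move=> x _ /=; rewrite -subr_ge0.
  have -> : a * f x ^+ 2 + 1 / a - 2 * f x = a * (f x - 1 / a) ^+ 2.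
    by field; rewrite gt_eqF.
  by rewrite mulr_ge0 ?sqr_ge0// ltW.
Qed.

Lemma chi2_dom_distribution d1 d2 (T1 : measurableType d1)
    (T2 : measurableType d2) (P Q : probability T1 R) (C : R)
    (X : {mfun T1 >-> T2}) :
  chi2_dom P Q C -> chi2_dom (distribution P X) (distribution Q X) C.
Proof.
move=> h f [mf f01].
have mX := measurable_funPT X.
have tr (P' : probability T1 R) (g : T2 -> R) : measurable_fun setT g ->
    (forall x, 0 <= g x <= 1) ->
    \int[distribution P' X]_x g x = \int[P']_x g (X x).
  move=> mg g01; rewrite /Rintegral ge0_integral_distribution//.
    exact/measurable_EFinP.
  by move=> y; rewrite lee_fin; case/andP: (g01 y).
have [mf2 f201] := unit_valued_sqr (conj mf f01).
by rewrite !tr//; apply: h; split => [|x]//; exact: measurableT_comp.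
Qed.

Lemma unit_valued_slice d1 d2 (T1 : measurableType d1)
    (T2 : measurableType d2) (f : T1 * T2 -> R) x :
  unit_valued f -> unit_valued (fun y => f (x, y)).
Proof.
move=> [mf f01]; split => [|y]//.
exact: (measurableT_comp mf (measurable_pair1 x)).
Qed.

Lemma unit_valued_Rintegral_slice d1 d2 (T1 : measurableType d1)
    (T2 : measurableType d2) (P2 : probability T2 R) (f : T1 * T2 -> R) :
  unit_valued f -> unit_valued (fun x => \int[P2]_y f (x, y)).
Proof.
move=> uf; split => [|x]; last first.
  exact/unit_valued_Rintegral/unit_valued_slice.
apply: measurableT_comp => //.
apply: (@measurable_fun_fubini_tonelli_F _ _ _ _ _ P2 (EFin \o f)).
  by apply/measurable_EFinP; case: uf.
by move=> z /=; rewrite lee_fin; case/andP: (uf.2 z).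
Qed.

Lemma Rintegral_prod_prob d1 d2 (T1 : measurableType d1)
    (T2 : measurableType d2) (P1 : probability T1 R) (P2 : probability T2 R)
    (f : T1 * T2 -> R) : unit_valued f ->
  \int[prod_prob P1 P2]_z f z = \int[P1]_x \int[P2]_y f (x, y).
Proof.
move=> uf; rewrite /Rintegral; congr fine.
transitivity (\int[P1 \x P2]_z (EFin \o f) z)%E; first exact: eq_measure_integral.
rewrite fubini_tonelli1/=; first last.
- by move=> z /=; rewrite lee_fin; case/andP: (uf.2 z).
- by apply/measurable_EFinP; case: uf.
apply: eq_integral => x _; rewrite /fubini_F.
exact/esym/(unit_valued_EFin_Rintegral P2 (unit_valued_slice x uf)).
Qed.

(** Integrate over the second variable first, then apply the domination of the
    first marginals to the function of x so obtained. Only almost every x has to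
    be good: the noise level of an observation is controlled only at the
    designs that are drawn with positive probability. *)
Lemma chi2_dom_kernel d1 d2 (T1 : measurableType d1)
    (T2 : measurableType d2) (P1 Q1 : probability T1 R)
    (P2 Q2 : probability T2 R) (C1 C2 : R) (f g : T1 * T2 -> R) :
  0 <= C1 -> 0 <= C2 -> chi2_dom P1 Q1 C1 -> unit_valued f -> unit_valued g ->
  {ae Q1, forall x, (\int[P2]_y f (x, y)) ^+ 2 <= C2 * \int[Q2]_y g (x, y)} ->
  (\int[prod_prob P1 P2]_z f z) ^+ 2 <= C1 * C2 * \int[prod_prob Q1 Q2]_z g z.
Proof.
move=> C10 C20 h uf ug fg; rewrite !Rintegral_prod_prob//.
have uF := unit_valued_Rintegral_slice P2 uf.
have uG := unit_valued_Rintegral_slice Q2 ug.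
apply: le_trans (h _ uF) _; rewrite -mulrA ler_wpM2l//.
rewrite -RintegralZl//; last exact: unit_valued_integrable uG.
have uF2 := unit_valued_sqr uF.
have iG : Q1.-integrable setT (fun x => (C2%:E * (\int[Q2]_y g (x, y))%:E)%E).
  by apply: integrableZl => //; exact: (unit_valued_integrable Q1 uG).
rewrite /Rintegral fine_le//.
- exact: integrable_fin_num (unit_valued_integrable Q1 uF2).
- exact: integrable_fin_num iG.
- apply: ae_ge0_le_integral => //.
  + by move=> x _; rewrite lee_fin; case/andP: (uF2.2 x).
  + by apply/measurable_EFinP; case: uF2.
  + by move=> x _; rewrite lee_fin mulr_ge0//; case/andP: (uG.2 x).
  + exact: measurable_int iG.
  + by apply: filterS fg => x /= fgx _; rewrite lee_fin.
Qed.

Lemma chi2_dom_prod_prob d1 d2 (T1 : measurableType d1)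
    (T2 : measurableType d2) (P1 Q1 : probability T1 R)
    (P2 Q2 : probability T2 R) (C1 C2 : R) :
  0 <= C1 -> 0 <= C2 -> chi2_dom P1 Q1 C1 -> chi2_dom P2 Q2 C2 ->
  chi2_dom (prod_prob P1 P2) (prod_prob Q1 Q2) (C1 * C2).
Proof.
move=> C10 C20 h1 h2 f uf.
apply: chi2_dom_kernel => //; first exact: unit_valued_sqr.
by apply: aeW => x; apply: h2; exact: unit_valued_slice.
Qed.

Lemma chi2_dom_iid_law d (T : measurableType d) (P Q : probability T R)
    (C : R) n : 0 <= C -> chi2_dom P Q C ->
  chi2_dom (iid_law P n) (iid_law Q n) (C ^+ n).
Proof.
move=> C0 h; elim: n => [|n ih]; first exact: chi2_dom_refl.
rewrite exprS; apply: chi2_dom_distribution.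
by apply: chi2_dom_prod_prob => //; exact: exprn_ge0.
Qed.

End ChiSquareDomination.

(** * Gaussian noise and the sampled observations *)

Section Gaussian.
Context (R : realType).

Lemma lebesgue_measure_translation (m : R) (A : set R) : measurable A ->
  lebesgue_measure [set x | A (m + x)] = lebesgue_measure A.
Proof.
move=> mA; have ms : measurable_fun [set: measurableTypeR R]
    (fun x : measurableTypeR R => m + x : measurableTypeR R).
  exact: measurable_funD.
rewrite [RHS](@lebesgue_measure_unique _
  (pushforward lebesgue_measure (fun x : measurableTypeR R => m + x : measurableTypeR R)))//.
move=> _ [[a b] _ <-]; rewrite /pushforward.
transitivity (@lebesgue_measure R `]a - m, b - m]%classic); last first.
  congr (lebesgue_measure _).
  by apply/seteqP; split => x; rewrite /= !in_itv/= ltrBlDl lerBrDl.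
rewrite !lebesgue_measure_itv/= !lte_fin ltrD2r; case: ifP => // _.
by rewrite -!EFinB; congr EFin; lra.
Qed.

(** The density is almost everywhere the Radon-Nikodym derivative, so that the
    change of variables for the latter applies. *)
Lemma integral_normal_prob (m s : R) (f : R -> R) :
  unit_valued (f : measurableTypeR R -> R) ->
  (\int[normal_prob m s]_x (f x)%:E =
   \int[lebesgue_measure]_x (f x * normal_pdf m s x)%:E)%E.
Proof.
move=> uf; have if_ := unit_valued_integrable (normal_prob m s) uf.
rewrite -(Radon_Nikodym_change_of_variables (normal_prob_dominates m s))//=.
apply: ae_eq_integral => //=.
- apply: emeasurable_funM => //; first by case/integrableP : if_.
  apply: (measurable_int lebesgue_measure).
  by apply: Radon_Nikodym_integrable; exact: normal_prob_dominates.
- apply/measurable_EFinP/measurable_funM => //; first by case: uf.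
  exact: measurable_normal_pdf.
- under [X in ae_eq _ _ _ X]eq_fun do rewrite EFinM.
  apply: ae_eqe_mul2l => /=.
  rewrite Radon_NikodymE//=; first exact: normal_prob_dominates.
  move=> abmu; case: cid => /= h [h1 h2 h3].
  apply: integral_ae_eq => //=.
    by apply/measurable_EFinP; exact: measurable_normal_pdf.
  by move=> E E01 mE; rewrite -h3.
Qed.

Lemma measurable_unit_valued_normal_pdf (f : R -> R) (m s : R) :
  unit_valued (f : measurableTypeR R -> R) ->
  measurable_fun [set: measurableTypeR R] (fun x => f x * normal_pdf m s x).
Proof.
by move=> [mf _]; apply: measurable_funM => //; exact: measurable_normal_pdf.
Qed.

Lemma integral_normal_prob_translation (m s : R) (f : R -> R) : s != 0 ->
  unit_valued (f : measurableTypeR R -> R) ->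
  (\int[normal_prob 0 s]_x (f (m + x))%:E = \int[normal_prob m s]_x (f x)%:E)%E.
Proof.
move=> s0 uf.
have mm : measurable_fun [set: measurableTypeR R]
    (fun x : measurableTypeR R => m + x : measurableTypeR R).
  exact: measurable_funD.
have ufm : unit_valued (fun x : measurableTypeR R => f (m + x)).
  by split => [|x]; [exact: (measurableT_comp uf.1 mm) | exact: uf.2].
rewrite (integral_normal_prob 0 s ufm) (integral_normal_prob m s uf).
pose g (y : measurableTypeR R) := (f y * normal_pdf m s y)%:E.
transitivity (\int[pushforward (@lebesgue_measure R)
    (fun x : measurableTypeR R => (m + x)%R : measurableTypeR R)]_y g y)%E; last first.
  apply: eq_measure_integral => A mA _.
  exact: lebesgue_measure_translation.
have mg : measurable_fun [set: measurableTypeR R] g.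
  by apply/measurable_EFinP; exact: measurable_unit_valued_normal_pdf.
have g0 y : (0 <= g y)%E.
  rewrite lee_fin; apply: mulr_ge0; last exact: normal_pdf_ge0.
  by case/andP: (uf.2 y).
rewrite (ge0_integral_pushforward mm _ measurableT mg (fun y _ => g0 y)).
apply: eq_integral => x _; rewrite /g /= !normal_pdfE// /normal_fun.
by rewrite subr0 [(m + x)%R]addrC addrK.
Qed.

Lemma Rintegral_normal_prob_translation (m s : R) (f : R -> R) : s != 0 ->
  unit_valued (f : measurableTypeR R -> R) ->
  \int[normal_prob 0 s]_x f (m + x) = \int[normal_prob m s]_x f x.
Proof.
move=> s0 uf; exact: (congr1 fine (integral_normal_prob_translation m s0 uf)).
Qed.

(** Completing the square: the likelihood ratio squared of N(m, s^2) against
    N(0, s^2), times the density of the latter, is a multiple of the density of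
    N(2m, s^2). This computes the second moment of the likelihood ratio. *)
Lemma normal_pdf_sqr (m s x : R) : s != 0 ->
  normal_pdf m s x ^+ 2 =
  expR (m ^+ 2 / s ^+ 2) * normal_pdf 0 s x * normal_pdf (m *+ 2) s x.
Proof.
move=> s0; rewrite !normal_pdfE// /normal_fun.
rewrite exprMn -expRM_natl.
rewrite [RHS](_ : _ = normal_peak s ^+ 2 * (expR (m ^+ 2 / s ^+ 2) *
  expR (- (x - 0) ^+ 2 / (s ^+ 2 *+ 2)) *
  expR (- (x - m *+ 2) ^+ 2 / (s ^+ 2 *+ 2)))); last by ring.
by rewrite -!expRD; congr (_ * expR _); field.
Qed.

(** With phi_m the density of N(m, s^2), the pointwise inequality
    2 f phi_m <= a f^2 phi_0 + phi_m^2 / (a phi_0) integrates, by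
    [normal_pdf_sqr], to 2 E_m f <= a E_0 f^2 + exp(m^2/s^2) / a. *)
Lemma chi2_dom_normal_prob (m s : R) : s != 0 ->
  chi2_dom (normal_prob m s) (normal_prob 0 s) (expR (m ^+ 2 / s ^+ 2)).
Proof.
move=> s0 f uf; set e := expR _.
have uf2 := unit_valued_sqr uf.
have e0 : 0 < e by exact: expR_gt0.
have /andP[I0 _] := unit_valued_Rintegral (normal_prob m s) uf.
have /andP[I2 _] := unit_valued_Rintegral (normal_prob 0 s) uf2.
apply: (sqr_le_of_affine_bounds e0 I0 I2) => a a0.
have := etrans (unit_valued_EFin_Rintegral (normal_prob m s) uf)
  (integral_normal_prob m s uf).
have := etrans (unit_valued_EFin_Rintegral (normal_prob 0 s) uf2)
  (integral_normal_prob 0 s uf2).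
move: (\int[normal_prob 0 s]_x (f x ^+ 2)) (\int[normal_prob m s]_x f x).
move=> Y X EY EX.
rewrite -lee_fin EFinD (EFinM 2) (EFinM a) EX EY {X Y EX EY}.
have mf1 := measurable_unit_valued_normal_pdf m s uf.
have mf2 := measurable_unit_valued_normal_pdf 0 s uf2.
have mf3 := measurable_normal_pdf (m *+ 2) s.
have f0 x : 0 <= f x by case/andP: (uf.2 x).
have ea0 : 0 <= e / a by rewrite ltW ?divr_gt0.
have p0 (m' x : R) : 0 <= normal_pdf m' s x by exact: normal_pdf_ge0.
have Zl (k : R) (g : R -> R) :
    0 <= k -> measurable_fun [set: measurableTypeR R] g -> (forall x, 0 <= g x) ->
    (k%:E * \int[lebesgue_measure]_x (g x)%:E =
     \int[lebesgue_measure]_x (k * g x)%:E)%E.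
  move=> k0 mg g0; rewrite -ge0_integralZl_EFin//.
    by move=> x _; rewrite lee_fin.
  exact/measurable_EFinP.
rewrite -[X in (_ <= _ + X)%E]mule1 -(integral_normal_pdf (m *+ 2) s).
have Z1 := Zl 2 _ (ler0n _ _) mf1 (fun x => mulr_ge0 (f0 x) (p0 m x)).
have Z2 := Zl a _ (ltW a0) mf2 (fun x => mulr_ge0 (sqr_ge0 (f x)) (p0 0 x)).
have Z3 := Zl (e / a) _ ea0 mf3 (p0 (m *+ 2)).
rewrite Z1 Z2 Z3 {Zl Z1 Z2 Z3}.
have mZ k (g : R -> R) : measurable_fun [set: measurableTypeR R] g ->
    measurable_fun [set: measurableTypeR R] (fun x => (k * g x)%:E).
  by move=> mg; apply/measurable_EFinP/measurable_funM.
rewrite -ge0_integralD; first last.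
- exact: mZ mf3.
- by move=> x _; rewrite lee_fin mulr_ge0.
- exact: mZ mf2.
- move=> x _; rewrite lee_fin.
  exact: (mulr_ge0 (ltW a0) (mulr_ge0 (sqr_ge0 _) (p0 _ _))).
- exact: measurableT.
apply: ge0_le_integral.
- exact: measurableT.
- by move=> x _; rewrite lee_fin !mulr_ge0.
- exact: mZ mf1.
- apply: emeasurable_funD; [exact: mZ mf2 | exact: mZ mf3].
move=> x _; rewrite -EFinD lee_fin.
have := normal_pdf_sqr m x s0; rewrite -/e.
have {}p0 : 0 < normal_pdf 0 s x.
  by rewrite normal_pdfE// mulr_gt0 ?normal_peak_gt0 ?expR_gt0.
move: (normal_pdf_ge0 m s x) p0.
move: (normal_pdf m s x) (normal_pdf 0 s x) (normal_pdf (m *+ 2) s x) => u v w u0 v0 uvw.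
have vn0 : v != 0 by rewrite gt_eqF.
have en0 : e != 0 by rewrite gt_eqF.
have an0 : a != 0 by rewrite gt_eqF.
have -> : w = u ^+ 2 / (e * v) by rewrite uvw; field; rewrite vn0.
rewrite -subr_ge0.
have -> : a * (f x ^+ 2 * v) + e / a * (u ^+ 2 / (e * v)) - 2 * (f x * u)
    = (a * v * f x - u) ^+ 2 / (a * v) by field; rewrite an0 vn0 en0.
by rewrite mulr_ge0 ?sqr_ge0// invr_ge0 mulr_ge0// ltW.
Qed.

End Gaussian.

Section ObservationLaw.
Variables (R : realType) (n p : nat) (n_gt0 : (0 < n)%N) (p_gt0 : (0 < p)%N).

Lemma mxinner_delta (i : 'I_n) (j : 'I_p) (M : 'M[R]_(n, p)) :
  mxinner (delta_mx i j) M = M i j.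
Proof.
rewrite /mxinner /mxtrace (bigD1 j)//= big1 ?addr0 => [|k kj].
  rewrite mxE (bigD1 i)//= big1 ?addr0 => [|l li].
    by rewrite !mxE !eqxx mul1r.
  by rewrite !mxE (negbTE li) mul0r.
rewrite mxE big1// => l _.
by rewrite !mxE (negbTE kj) andbF mul0r.
Qed.

Lemma observe0 (X : borelM R n p) (y : measurableTypeR R) :
  observe (0 : 'M[R]_(n, p)) (X, y) = (y, X).
Proof.
congr (_, _); rewrite [X in X + _](_ : _ = 0) ?add0r//.
by rewrite /mxinner mulmx0 mxtrace0.
Qed.

Lemma ae_uniform_design (A : set (borelM R n p)) : measurable A ->
  (forall i j, A (delta_mx i j)) ->
  {ae uniform_design R n_gt0 p_gt0, forall X, A X}.
Proof.
move=> mA hA; exists (~` A); split => //; first exact: measurableC.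
rewrite /= /uniform_design big1 ?mule0// => -[i j] _ /=.
by rewrite diracE memNset//= => /(_ (hA i j)).
Qed.

(** Given the design e_n(i) e_p(j)^T, the two laws of the response are
    N(M i j, sigma^2) and N(0, sigma^2); the design itself has the same law
    under both. *)
Lemma chi2_dom_obs_law (sigma h : R) (M : 'M[R]_(n, p)) : sigma != 0 ->
  (forall i j, `|M i j| <= h) ->
  chi2_dom (obs_law n_gt0 p_gt0 sigma M) (obs_law n_gt0 p_gt0 sigma 0)
    (expR (h ^+ 2 / sigma ^+ 2)).
Proof.
move=> s0 hM f uf; set C := expR _.
have C0 : 0 <= C by exact: expR_ge0.
have tr M' (g : measurableTypeR R * borelM R n p -> R) : unit_valued g ->
    \int[obs_law n_gt0 p_gt0 sigma M']_x g x =
    \int[prod_prob (uniform_design R n_gt0 p_gt0) (normal_prob 0 sigma)]_x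
      g (observe M' x).
  move=> [mg g01]; rewrite /Rintegral ge0_integral_distribution//.
    exact/measurable_EFinP.
  by move=> y; rewrite lee_fin; case/andP: (g01 y).
have uo M' (g : measurableTypeR R * borelM R n p -> R) : unit_valued g ->
    unit_valued (fun x => g (observe M' x)).
  by move=> [mg g01]; split => //; exact: measurableT_comp.
rewrite (tr M)// (tr 0); last exact: unit_valued_sqr.
rewrite -[C]mul1r; apply: chi2_dom_kernel => //.
- exact: chi2_dom_refl.
- exact: uo.
- exact: (uo _ _ (unit_valued_sqr uf)).
have mD : measurable [set X : borelM R n p | `|mxinner X M| <= h].
  have mn : measurable_fun setT (fun X : borelM R n p => `|mxinner X M|).
    by apply: measurableT_comp => //; exact: measurable_mxinner.
  rewrite -[X in measurable X]setTI.
  rewrite (_ : [set X | _] = (fun X : borelM R n p => `|mxinner X M|) @^-1` `]-oo, h]).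
    exact: mn.
  by apply/seteqP; split => X /=; rewrite in_itv.
apply: filterS (ae_uniform_design mD _); last first.
  by move=> i j /=; rewrite mxinner_delta.
move=> X /= hX.
have uX : unit_valued (fun y : measurableTypeR R => f (y, X)).
  split => [|y]; last exact: uf.2.
  exact: (measurableT_comp uf.1 (measurable_pair2 X)).
pose g (y : measurableTypeR R) := f (y, X).
have -> : (fun y : measurableTypeR R => f (observe M (X, y))) =
    (fun y => g (mxinner X M + y)) by [].
have -> : (fun y : measurableTypeR R => f (observe 0 (X, y)) ^+ 2) =
    (fun y => g y ^+ 2).
  by apply/funext => y; rewrite observe0.
rewrite (Rintegral_normal_prob_translation (mxinner X M) s0 (uX : unit_valued g)).
apply: le_trans (chi2_dom_normal_prob _ s0 uX) _.
apply: ler_wpM2r.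
  by case/andP: (unit_valued_Rintegral (normal_prob 0 sigma) (unit_valued_sqr uX)).
rewrite ler_expR ler_wpM2r ?invr_ge0 ?sqr_ge0//.
by rewrite -real_normK ?num_real// ler_sqr ?nnegrE ?(le_trans _ hX).
Qed.

Lemma chi2_dom_sample_law (sigma h : R) (M : 'M[R]_(n, p)) N : sigma != 0 ->
  (forall i j, `|M i j| <= h) ->
  chi2_dom (sample_law n_gt0 p_gt0 sigma M N) (sample_law n_gt0 p_gt0 sigma 0 N)
    (expR (N%:R * h ^+ 2 / sigma ^+ 2)).
Proof.
move=> s0 hM; rewrite -mulrA expRM_natl.
by apply: chi2_dom_iid_law; [exact: expR_ge0 | exact: chi2_dom_obs_law].
Qed.

End ObservationLaw.

(** * Testing many hypotheses *)

Section Testing.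
Context (R : realType) d (T : measurableType d) (W : finType).

(** If every sample fits at most V hypotheses, then the Q-masses of the events
    E w add up to at most V. Domination turns this into a bound on the P w (E w),
    through x <= 1/4 + x^2 <= 1/4 + C * Q (E w). *)
Lemma chi2_testing (P : W -> probability T R) (Q : probability T R)
    (E : W -> set T) (C V : R) :
  (0 < #|W|)%N -> 0 <= C -> (forall w, measurable (E w)) ->
  (forall w, chi2_dom (P w) Q C) ->
  (forall z, #|[pred w | `[< E w z >]]|%:R <= V) ->
  4 * C * V <= #|W|%:R ->
  exists w, (P w (E w) <= (2^-1)%:E)%E.
Proof.
move=> W0 C0 mE PQ EV CV; apply: contrapT => /forallNP noE.
pose f w : T -> R := \1_(E w).
have uf w : unit_valued (f w).
  split; first exact: measurable_indic.
  by move=> x; rewrite /f indicE; case: (_ \in _); rewrite ?ler01 ?lexx.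
have intf (P' : probability T R) w : (\int[P']_x f w x)%:E = P' (E w).
  rewrite (unit_valued_EFin_Rintegral P' (uf w)) integral_indic// setIT.
  by [].
have sq w x : f w x ^+ 2 = f w x.
  by rewrite /f indicE; case: (_ \in _); rewrite ?expr1n ?expr0n.
have sumQ : \sum_w \int[Q]_x f w x <= V.
  rewrite -lee_fin -sumEFin.
  under eq_bigr do rewrite (unit_valued_EFin_Rintegral Q (uf _)).
  rewrite -ge0_integral_sum//; first last.
  - by move=> w x _; rewrite lee_fin; case/andP: ((uf w).2 x).
  - by move=> w; apply/measurable_EFinP; case: (uf w).
  have -> : V%:E = (\int[Q]_x (cst V%:E x))%E.
    by rewrite integral_cst// [X in (_ * X)%E]probability_setT mule1.
  apply: ge0_le_integral => //.
  - by move=> x _; apply: sume_ge0 => w _; rewrite lee_fin; case/andP: ((uf w).2 x).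
  - apply: emeasurable_sum => w; apply/measurable_EFinP; by case: (uf w).
  move=> x _; rewrite sumEFin lee_fin; apply: le_trans (EV x).
  rewrite -sum1_card natr_sum [leRHS]big_mkcond /=; apply: ler_sum => w _.
  by rewrite /f indicE inE; case: asboolP => [h|h]; [rewrite mem_set|rewrite memNset].
have pw w : 1 / 2 < \int[P w]_x f w x.
  by rewrite -lte_fin intf ltNge div1r; apply/negP/noE.
have pq w : \int[P w]_x f w x <= 1 / 4 + C * \int[Q]_x f w x.
  have := PQ w _ (uf w); rewrite (_ : (fun x => f w x ^+ 2) = f w); last first.
    exact/funext.
  move: (\int[P w]_x f w x) (C * \int[Q]_x f w x) => p c h.
  have : 0 <= (p - 1 / 2) ^+ 2 by exact: sqr_ge0.
  by move: h; rewrite !expr2; lra.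
(* If every P w (E w) exceeded 1/2, then so would their average. *)
have [w0 _] : exists w0 : W, w0 \in W.
  by move/card_gt0P: W0 => [w _]; exists w.
have : \sum_(w : W) (1 / 2 : R) < \sum_w \int[P w]_x f w x.
  apply: ltr_sum => [|w _]; last exact: pw.
  by apply/hasP; exists w0; rewrite ?mem_index_enum.
have : \sum_w \int[P w]_x f w x <= \sum_w (1 / 4 + C * \int[Q]_x f w x).
  by apply: ler_sum => w _.
rewrite big_split /= -(mulr_sumr _ _ _ C).
have cst (r : R) : \sum_(w : W) r = r * #|W|%:R by rewrite sumr_const mulr_natr.
rewrite !cst.
have := ler_wpM2l C0 sumQ; move: CV.
by move: (\sum_w _) (\sum_w _) (#|W|%:R : R) => S S' c; lra.
Qed.

End Testing.

Section Packing.

(** An exponential moment bound: give a word the weight J^a, where J = s^2 and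
    a is the number of its agreements with a fixed member of S. Members of S
    have weight at least J^(D/2) = s^D, and the total weight is
    (2J - 1)^D because it factors over the positions. *)
Lemma card_hamming_cluster (D : finType) (s : nat) (S : {set {ffun D -> 'I_(s ^ 2)}}) :
  (0 < s)%N ->
  (forall w w', w \in S -> w' \in S -> (2 * #|[pred x | w x != w' x]| <= #|D|)%N) ->
  (#|S| <= (2 * s) ^ #|D|)%N.
Proof.
move=> s0 close; have [->|[w0 w0S]] := set_0Vmem S; first by rewrite cards0.
pose wt (x : D) (a : 'I_(s ^ 2)) := if a == w0 x then (s ^ 2)%N else 1%N.
have total : (\sum_(w : {ffun D -> 'I_(s ^ 2)}) \prod_x wt x (w x) <=
    (2 * s ^ 2) ^ #|D|)%N.
  rewrite -(bigA_distr_bigA wt) -prod_nat_const; apply: leq_prod => x _.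
  rewrite (bigD1 (w0 x))//= /wt eqxx mul2n -addnn leq_add2l.
  under eq_bigr => a /negbTE -> do [].
  by rewrite sum1_card (leq_trans (max_card _))// card_ord.
have each w : w \in S -> (s ^ #|D| <= \prod_x wt x (w x))%N.
  move=> wS; have -> : (\prod_x wt x (w x) = (s ^ 2) ^ #|[pred x | w x == w0 x]|)%N.
    rewrite -prod_nat_const [RHS]big_mkcond /=; apply: eq_bigr => x _.
    by rewrite /wt inE.
  rewrite -expnM leq_pexp2l//; have := close _ _ wS w0S.
  have := cardC [pred x | w x == w0 x].
  have -> : #|[predC [pred x | w x == w0 x]]| = #|[pred x | w x != w0 x]| by exact: eq_card.
  by move: #|D| #|[pred x | w x == w0 x]| #|[pred x | w x != w0 x]| => a b c; lia.
have : (#|S| * s ^ #|D| <= (2 * s ^ 2) ^ #|D|)%N.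
  apply: leq_trans total; rewrite -sum_nat_const [leqLHS]big_mkcond /=.
  by apply: leq_sum => w _; case: ifP => // /each.
have -> : (2 * s ^ 2 = 2 * s * s)%N by rewrite mulnA.
by rewrite expnMn leq_pmul2r// expn_gt0 s0.
Qed.

End Packing.

Section BalancedAssignment.
Context (R : realType) (G : finType) (n : nat).

(** Assign the rows cyclically; a class gets at least n %/ #|G| rows, which is
    more than half of n / #|G| as #|G| <= n. *)
Lemma balanced_assignment : (0 < #|G| <= n)%N ->
  exists q : 'I_n -> G, forall F : G -> R, (forall g, 0 <= F g) ->
    n%:R / (2 * #|G|%:R) * \sum_g F g <= \sum_i F (q i).
Proof.
move=> /andP[G0 Gn]; pose q' m : G := enum_val (Ordinal (ltn_pmod m G0)).
exists (fun i => q' i) => F F0; pose Q := #|G|; pose c := (n %/ Q)%N.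
have period m : q' (m + Q)%N = q' m.
  by congr enum_val; apply: val_inj; rewrite /= modnDr.
have base : \sum_(0 <= m < Q) F (q' m) = \sum_g F g.
  rewrite big_mkord (reindex (@enum_val G predT)) /=; last first.
    exact/onW_bij/enum_val_bij.
  apply: eq_bigr => i _; congr (F (enum_val _)).
  by apply: val_inj; rewrite /= modn_small.
have blocks m : \sum_(0 <= i < m * Q) F (q' i) = m%:R * \sum_g F g.
  elim: m => [|m ih]; first by rewrite mul0n big_geq// mul0r.
  rewrite mulSn -base (big_cat_nat _ (n := Q)) ?leq_addr//=.
  rewrite -{2}[Q]add0n big_addn addKn.
  under [X in _ + X]eq_bigr do rewrite period.
  by rewrite ih base -natr1 mulrDl mul1r addrC.
rewrite -(big_mkord xpredT (fun i => F (q' i))) (big_cat_nat _ (n := c * Q)%N)//=;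
  last exact: leq_divM.
rewrite blocks; apply: (@le_trans _ _ (c%:R * \sum_g F g)); last first.
  by rewrite lerDl sumr_ge0.
apply: ler_wpM2r; first exact: sumr_ge0.
rewrite ler_pdivrMr ?mulr_gt0 ?ltr0n// mulrA -!natrM ler_nat.
have c0 : (0 < c)%N by rewrite divn_gt0.
have := ltn_ceil n G0; rewrite -/c -/Q; nia.
Qed.

End BalancedAssignment.

(** * A smooth bump and its derivatives *)

Section OneDimensionalBump.
Context (R : realType).
Implicit Types (u v : R) (e m : nat).

(** The difference quotient at u differs from 2 max(0, u) by at most |h|. *)
Lemma is_derive_pos_sqr u : is_derive u 1 (fun v => Num.max 0 v ^+ 2) (2 * Num.max 0 u).
Proof.
have cv : (fun h => h^-1 *: (((fun v => Num.max 0 v ^+ 2) \o shift u) (h *: (1 : R)) -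
     Num.max 0 u ^+ 2)) @ 0^' --> (2 * Num.max 0 u : R^o).
  apply/cvgrPdist_le => eps eps0; near=> h.
  have h0 : h != 0 by near: h; exact: nbhs_dnbhs_neq.
  have hh : `|h| <= eps.
    near: h; exact: (@dnbhs0_le _ R^o).
  apply: le_trans hh.
  rewrite /= [h *: 1]mulr1 [_ *: _]mulrC.
  have -> : 2 * Num.max 0 u - (Num.max 0 (h + u) ^+ 2 - Num.max 0 u ^+ 2) / h =
    (2 * h * Num.max 0 u - (Num.max 0 (h + u) ^+ 2 - Num.max 0 u ^+ 2)) / h by field.
  rewrite normrM normfV ler_pdivrMr ?normr_gt0// -expr2 real_normK ?num_real//.
  have [u0|u0] := leP 0 u; have [v0|v0] := leP 0 (h + u); rewrite ler_norml; nra.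
by apply: DeriveDef; [apply/cvg_ex; eexists; exact: cv | exact: cvg_lim cv].
Unshelve. all: by end_near. Qed.

Lemma is_derive_pos_exp e u :
  is_derive u 1 (fun v => Num.max 0 v ^+ e.+2) (e.+2%:R * Num.max 0 u ^+ e.+1).
Proof.
elim: e => [|e ih]; first by rewrite expr1; exact: is_derive_pos_sqr.
have mm v : v * Num.max 0 v = Num.max 0 v ^+ 2 :> R.
  by have [v0|v0] := leP 0 v; rewrite ?mulr0 ?expr0n// expr2.
have -> : (fun v : R => Num.max 0 v ^+ e.+3) = (id * (fun v => Num.max 0 v ^+ e.+2)).
  apply/funext => v; rewrite [RHS]/(v * Num.max 0 v ^+ e.+2).
  by rewrite [in RHS]exprS [RHS]mulrA mm -exprD.
apply: is_derive_eq.
rewrite [LHS]/(u * (e.+2%:R * Num.max 0 u ^+ e.+1) + Num.max 0 u ^+ e.+2 * 1).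
rewrite mulrCA (exprS _ e) [u * _]mulrA mm -exprD mulr1.
by rewrite -(natr1 e.+2) [RHS]mulrDl [1 * _]mul1r.
Qed.

(** The polynomial factors of the derivatives of max(0, v - v^2)^e: by the product
    rule, differentiating P(v) * max(0, v - v^2)^j lowers the exponent j by one
    and replaces P by P' * (X - X^2) + j * P * (1 - 2X). At the m-th step the
    exponent is e - m. *)
Fixpoint bump_poly e m : {poly R} :=
  if m is m'.+1 then
    (bump_poly e m')^`() * ('X - 'X^2) +
    bump_poly e m' * ((e - m')%:R%:P * (1 - 'X *+ 2))
  else 1.

(** The m-th derivative of max(0, v - v^2)^e, for m < e. This bump supported by
    [0, 1] has as many derivatives as needed for a large e, and they are explicit. *)
Definition bump e m v : R := (bump_poly e m).[v] * Num.max 0 (v - v ^+ 2) ^+ (e - m).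

Lemma is_derive_bump e m v : (m.+1 < e)%N ->
  is_derive v 1 (bump e m) (bump e m.+1 v).
Proof.
move=> me.
have [j Ej] : exists j, (e - m = j.+2)%N.
  by exists (e - m).-2; move: me; rewrite -subn_gt0 subnS; case: (e - m)%N => [|[]].
have -> : bump e m = horner (bump_poly e m) *
    ((fun v => Num.max 0 v ^+ j.+2) \o (fun v : R => v - v ^+ 2)).
  by apply/funext => w; rewrite /bump Ej.
have d1 : is_derive v 1 (fun v : R => v - v ^+ 2) (1 - 2 * v).
  apply: is_derive_eq.
  by change (1 - (v * 1 + v * 1) = 1 - 2 * v :> R); rewrite mulr1 mulr2n mulrDl mul1r.
have d2 := is_derive_pos_exp j (v - v ^+ 2).
have d3 := @is_derive1_comp _ (fun v : R => Num.max 0 v ^+ j.+2)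
  (fun v : R => v - v ^+ 2) _ _ _ d2 d1.
apply: is_derive_eq.
rewrite /bump /= subnS Ej /= !hornerE.
set M := Num.max 0 _; set a := (bump_poly e m).[v].
have -> : M ^+ j.+2 = (v - v ^+ 2) * M ^+ j.+1.
  rewrite (exprS _ j.+1) !(exprS _ j) !mulrA; congr (_ * _).
  by rewrite /M; have [?|?] := leP 0 (v - v ^+ 2); rewrite ?mulr0.
change (a * (j.+2%:R * M ^+ j.+1 * (1 - 2 * v)) +
  (v - v ^+ 2) * M ^+ j.+1 * ((bump_poly e m)^`()).[v] =
  (((bump_poly e m)^`()).[v] * (v - v ^+ 2) + a * j.+2%:R * (1 - (v + v))) * M ^+ j.+1).
by ring.
Qed.

Lemma bump_out e m v : (m < e)%N -> ~~ (0 < v < 1) -> bump e m v = 0.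
Proof.
move=> me v01; rewrite /bump; have -> : Num.max 0 (v - v ^+ 2) = 0.
  apply/max_idPl; rewrite subr_le0 expr2; move: v01; rewrite negb_and -!leNgt => /orP[]; nra.
by rewrite expr0n subn_eq0 leqNgt me mulr0.
Qed.

Lemma bump_half e : bump e 0 (1 / 2) = (1 / 4) ^+ e.
Proof.
rewrite /bump /= hornerC mul1r subn0; congr (_ ^+ _).
have -> : 1 / 2 - (1 / 2) ^+ 2 = 1 / 4 :> R by field.
by apply/max_idPr; lra.
Qed.

Lemma bump_bounded e : exists2 B : R, 1 <= B & forall m v, (m < e)%N -> `|bump e m v| <= B.
Proof.
exists (1 + \sum_(m < e) \sum_(i < size (bump_poly e m)) `|(bump_poly e m)`_i|).
  by rewrite lerDl sumr_ge0// => m _; rewrite sumr_ge0.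
move=> m v me; have [v01|/(bump_out me)->] := boolP (0 < v < 1); last first.
  by rewrite normr0 addr_ge0// sumr_ge0// => ? _; rewrite sumr_ge0.
have /andP[v0 v1] := v01.
rewrite (bigD1 (Ordinal me))//= addrCA.
apply: (@le_trans _ _ (\sum_(i < size (bump_poly e m)) `|(bump_poly e m)`_i|)); last first.
  by rewrite lerDl addr_ge0// sumr_ge0// => ? _; rewrite sumr_ge0.
rewrite /bump normrM horner_coef.
apply: (@le_trans _ _ (`|\sum_(i < size (bump_poly e m)) (bump_poly e m)`_i * v ^+ i| * 1)).
  apply: ler_wpM2l => //; rewrite normrX exprn_ile1// ger0_norm ?le_max ?lexx//.
  by rewrite ge_max ler01/=; nra.
rewrite mulr1; apply: le_trans (ler_norm_sum _ _ _) _; apply: ler_sum => i _.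
rewrite normrM ler_piMr// normrX exprn_ile1//.
by rewrite ger0_norm ltW.
Qed.

End OneDimensionalBump.

(** * Towers of partial derivatives on the cube *)

Section DerivativeTower.
Context (R : realType) (K : nat).
Implicit Types (f g : 'rV[R]_K -> R) (x y : 'rV[R]_K) (k : 'I_K) (a l : 'I_K -> nat).

Definition partial_quotient k f x : R -> R := fun h =>
  h^-1 * (f (x + h *: delta_mx ord0 k) - f x).

(** A segment of positive length leaves x inside the cube in each coordinate
    direction, on one side at least, so that limits along it are unique. *)
Lemma cube_line_proper x k : cube x ->
  ProperFilter (within [set h | cube (x + h *: delta_mx ord0 k)] (0^' : set_system R)).
Proof.
move=> cx; apply: Build_ProperFilter_ex => A.
rewrite /within => /nbhs_ballP[eps /= e0 hA].
pose d := Num.min (eps / 2) (1 / 2).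
have d0 : 0 < d by rewrite lt_min; apply/andP; split; lra.
have de : d < eps by rewrite gt_min; apply/orP; left; lra.
have d2 : d <= 1 / 2 by rewrite ge_min lexx orbT.
have /andP[xk0 xk1] := cx k.
have cubeP (h : R) : 0 <= x ord0 k + h <= 1 ->
    cube (x + h *: delta_mx ord0 k).
  move=> hh i; rewrite !mxE eqxx /=; have [->|ik] := eqVneq i k.
    by rewrite mulr1.
  by rewrite mulr0 addr0.
have [x2|x2] := leP (x ord0 k) (1 / 2).
  exists d; apply: hA.
  - by rewrite /ball /= sub0r normrN gtr0_norm.
  - by rewrite gt_eqF.
  - by apply: cubeP; apply/andP; split; lra.
exists (- d); apply: hA.
- by rewrite /ball /= sub0r opprK gtr0_norm.
- by rewrite oppr_eq0 gt_eqF.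
- by apply: cubeP; apply/andP; split; lra.
Qed.

(** Limits inside the cube only see the values on the cube, and agree with the
    two-sided limits whenever the latter exist. *)
Lemma cube_partialE f g k x (dg : R) : (forall y, cube y -> f y = g y) -> cube x ->
  partial_quotient k g x @ 0^' --> dg -> cube_partial k f x = dg.
Proof.
move=> fg cx cg; have FF := cube_line_proper k cx.
rewrite /cube_partial; apply: cvg_lim => //.
have cgw : partial_quotient k g x
    @ within [set h | cube (x + h *: delta_mx ord0 k)] 0^' --> dg.
  by apply: cvg_trans cg; apply: cvg_app; exact: cvg_within.
apply: cvg_trans cgw; apply: near_eq_cvg.
apply: filterS (withinT _ (dnbhs_filter _)) => h /= ch.
by rewrite /partial_quotient !fg.
Qed.

Lemma cube_differentiableE f g x : (forall y, cube y -> f y = g y) -> cube x ->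
  differentiable (g : 'rV[R]_K -> R^o) x -> cube_differentiable f x.
Proof.
move=> fg cx dg; exists ('d (g : 'rV[R]_K -> R^o) x) => eps e0.
have [_ /eqaddoP/(_ eps e0) h] := (diff_locallyP _ _).1 dg.
suff : \forall y \near x, cube y ->
    `|f y - f x - 'd (g : 'rV[R]_K -> R^o) x (y - x)| <= eps * `|y - x| by [].
rewrite (near_shift 0 x) subr0.
apply: filterS h => z /=; rewrite /shift/= addrK => hz cz.
rewrite !fg// -addrA -opprD.
exact: le_trans hz.
Qed.

Definition bump_index a k : 'I_K -> nat := fun i => (a i + (i == k))%N.

Lemma sum_bump_index a k : (\sum_i bump_index a k i = (\sum_i a i).+1)%N.
Proof.
have d1 : (\sum_i (i == k) = 1)%N.
  by rewrite (bigD1 k)//= eqxx big1// => i /negbTE->.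
by rewrite big_split /= d1 addn1.
Qed.

Variables (L : nat) (T : ('I_K -> nat) -> 'rV[R]_K -> R).
Hypothesis T_diff : forall a x, (\sum_i a i < L)%N ->
  differentiable (T a : 'rV[R]_K -> R^o) x.
Hypothesis T_partial : forall a k x, (\sum_i a i < L)%N ->
  partial_quotient k (T a) x @ 0^' --> T (bump_index a k) x.

Lemma tower_ntimes_differentiable m a f : (\sum_i a i + m <= L)%N ->
  (forall y, cube y -> f y = T a y) -> ntimes_differentiable m f.
Proof.
elim: m a f => [//|m ih] a f am fT.
have aL : (\sum_i a i < L)%N by apply: leq_trans am; rewrite addnS ltnS leq_addr.
split => [x cx|k]; first exact: (cube_differentiableE fT cx (T_diff x aL)).
apply: (ih (bump_index a k)); first by rewrite sum_bump_index addSnnS.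
move=> x cx; apply: (cube_partialE fT cx); exact: T_partial.
Qed.

Lemma tower_iter k j a f : (\sum_i a i + j <= L)%N ->
  (forall y, cube y -> f y = T a y) ->
  forall y, cube y ->
    iter j (cube_partial k) f y = T (fun i => a i + (i == k) * j)%N y.
Proof.
elim: j => [|j ih] aj fT y cy.
  by rewrite /= fT//; congr T; apply/funext => i; rewrite muln0 addn0.
have {}ih := ih (leq_trans (leq_add (leqnn _) (leqnSn j)) aj) fT.
rewrite iterS (cube_partialE ih cy (@T_partial _ k y _)).
  by congr T; apply/funext => i; rewrite /bump_index mulnS addnA addnAC.
suff -> : (\sum_i (a i + (i == k) * j) = \sum_i a i + j)%N by rewrite -addnS.
rewrite big_split /=; congr addn.
by rewrite (bigD1 k)//= eqxx mul1n big1 ?addn0// => i /negbTE->.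
Qed.

Lemma tower_mixed_partial l : (\sum_i l i <= L)%N -> forall x, cube x ->
  cube_mixed_partial l (T (fun=> 0%N)) x = T l x.
Proof.
move=> lL; rewrite /cube_mixed_partial.
have : forall r : seq 'I_K, uniq r -> forall x, cube x ->
  foldr (fun k g => iter (l k) (cube_partial k) g) (T (fun=> 0%N)) r x =
  T (fun i => (i \in r) * l i)%N x.
  elim=> [_ x cx /=|k r ih /= /andP[kr ur] x cx].
    by congr T; apply/funext => i.
  rewrite (tower_iter _ _ (ih ur) cx).
    congr T; apply/funext => i; rewrite inE.
    by have [->|ik] := eqVneq i k; rewrite ?(negbTE kr) ?mul1n ?mul0n// addn0.
  apply: leq_trans lL; rewrite (bigD1 k)//= (negbTE kr) mul0n add0n addnC.
  rewrite [leqRHS](bigD1 k)//= leq_add2l; apply: leq_sum => i _.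
  by case: (i \in r); rewrite ?mul1n// mul0n.
move=> /(_ (enum 'I_K) (enum_uniq _)) h x cx; rewrite h//; congr T.
by apply/funext => i; rewrite mem_enum inE mul1n.
Qed.

(** A family T indexed by multi-indices, in which T (a + e_k) is the k-th partial
    derivative of T a, settles at once all the iterated partial derivatives of
    T 0, whatever the order of differentiation. *)
Lemma tower_smooth_class (gamma : R) :
  (forall a x, (\sum_i a i)%N = L -> cube x -> `|T a x| <= gamma) ->
  smooth_class L gamma (T (fun=> 0%N)).
Proof.
move=> Tb; split.
  by apply: (@tower_ntimes_differentiable L (fun=> 0%N)) => //; rewrite big1.
by move=> l lL x cx; rewrite tower_mixed_partial ?lL// Tb.
Qed.

End DerivativeTower.

(** * Interpolation on a grid by smooth functions *)

Section ProductTower.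
Context (R : realType) (K : nat) (I : finType) (L : nat).
Variables (g : I -> nat -> R -> R) (c : {ffun 'I_K -> I} -> R).
Hypothesis g_derive : forall j m (u : R), (m < L)%N ->
  is_derive u 1 (g j m) (g j m.+1 u).
Implicit Types (a : 'I_K -> nat) (x : 'rV[R]_K) (k : 'I_K).

(** Here g j m stands for the m-th derivative of a function g j of one variable. *)
Definition product_tower a x : R :=
  \sum_q c q * \prod_i g (q i) (a i) (x ord0 i).

Lemma index_lt a : (\sum_i a i < L)%N -> forall i, (a i < L)%N.
Proof. by move=> aL i; apply: leq_ltn_trans aL; rewrite (bigD1 i)//= leq_addr. Qed.

Lemma product_tower_diff a x : (\sum_i a i < L)%N ->
  differentiable (product_tower a : 'rV[R]_K -> R^o) x.
Proof.
move=> /index_lt aL.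
have dp (q : {ffun 'I_K -> I}) (r : seq 'I_K) : differentiable
    (fun y : 'rV[R]_K => \prod_(i <- r) g (q i) (a i) (y ord0 i) : R^o) x.
  elim: r => [|i r ih].
    by under eq_fun do rewrite big_nil; exact: differentiable_cst.
  under eq_fun do rewrite big_cons.
  apply: differentiableM => //.
  apply: (@differentiable_comp _ _ _ _ (fun y : 'rV[R]_K => y ord0 i : R) (g (q i) (a i))).
    exact: differentiable_coord.
  by apply/derivable1_diffP; exact: (@ex_derive _ _ _ _ _ _ _ (g_derive (q i) _ (aL i))).
rewrite /product_tower; elim: index_enum => [|q r ih].
  by under eq_fun do rewrite big_nil; exact: differentiable_cst.
under eq_fun do rewrite big_cons.
apply: differentiableD => //.
by apply: differentiableM; [exact: differentiable_cst | exact: dp].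
Qed.

(** On a line in direction k only the k-th factor of each product varies, so the
    partial derivative reduces to derivatives in one variable. *)
Lemma product_tower_partial a k x : (\sum_i a i < L)%N ->
  partial_quotient k (product_tower a) x @ 0^' --> product_tower (bump_index a k) x.
Proof.
move=> /index_lt aL.
pose w (q : {ffun 'I_K -> I}) := \prod_(i | i != k) g (q i) (a i) (x ord0 i).
have E (h : R) : partial_quotient k (product_tower a) x h =
    \sum_q c q * w q *
      (h^-1 *: ((g (q k) (a k) \o shift (x ord0 k)) (h *: (1 : R)) -
                g (q k) (a k) (x ord0 k))).
  rewrite /partial_quotient /product_tower -sumrB mulr_sumr; apply: eq_bigr => q _.
  rewrite (bigD1 k)//= [in X in _ - X](bigD1 k)//= !mxE !eqxx /=.
  have -> : \prod_(i < K | i != k) g (q i) (a i) ((x + h *: delta_mx ord0 k) ord0 i)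
      = w q.
    by apply: eq_bigr => i ik; rewrite !mxE (negbTE ik) andbF mulr0 addr0.
  rewrite -/(w q) [h *: 1]mulr1 [h + _]addrC mulr1 [_ *: _]mulrC.
  by ring.
rewrite (funext E).
have -> : product_tower (bump_index a k) x =
    \sum_q c q * w q * g (q k) (a k).+1 (x ord0 k).
  apply: eq_bigr => q _; rewrite (bigD1 k)//= /bump_index eqxx addn1.
  rewrite -mulrA [w q * _]mulrC; congr (_ * (_ * _)).
  by apply: eq_bigr => i ik; rewrite (negbTE ik) addn0.
apply: cvg_big => [|q _]; first exact: add_continuous.
apply: cvgM; first exact: cvg_cst.
have d := g_derive (q k) (x ord0 k) (aL k).
by have [+ <-] := d; exact.
Qed.

End ProductTower.

Section GridInterpolation.
Context (R : realType).
Local Notation bump := (@bump R).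

Definition cell_center (K k : nat) (q : {ffun 'I_K -> 'I_k}) : 'rV[R]_K :=
  \row_i (((q i)%:R + 1 / 2) / k%:R).

Lemma cell_center_cube K k (q : {ffun 'I_K -> 'I_k}) : cube (cell_center q).
Proof.
move=> i; rewrite mxE; have qk := ltn_ord (q i).
have k0 : 0 < k%:R :> R by rewrite ltr0n (leq_ltn_trans _ qk).
have q0 : 0 <= (q i)%:R :> R by exact: ler0n.
rewrite ler_pdivlMr// ler_pdivrMr// mul0r mul1r; apply/andP; split; first by lra.
have : (q i).+1%:R <= k%:R :> R by rewrite ler_nat.
by rewrite -natr1; lra.
Qed.

Lemma is_derive_scaled_bump e k (j m : nat) (u : R) : (m.+1 < e)%N ->
  is_derive u 1 (fun v => k%:R ^+ m * bump e m (k%:R * v - j%:R))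
    (k%:R ^+ m.+1 * bump e m.+1 (k%:R * u - j%:R)).
Proof.
move=> me; have d1 : is_derive u 1 (fun v : R => k%:R * v - j%:R) k%:R.
  apply: is_derive_eq.
  by rewrite subr0 [LHS]mulr1.
have d2 := is_derive_bump (k%:R * u - j%:R) me.
have d3 := @is_derive1_comp _ (bump e m) (fun v : R => k%:R * v - j%:R) _ _ _ d2 d1.
have -> : (fun v => k%:R ^+ m * bump e m (k%:R * v - j%:R)) =
   cst (k%:R ^+ m) * (bump e m \o (fun v : R => k%:R * v - j%:R)) by [].
apply: is_derive_eq.
rewrite scaler0 addr0; set b := bump e m.+1 _.
change (k%:R ^+ m * (b * k%:R) = k%:R ^+ m.+1 * b :> R).
by rewrite exprSr mulrCA mulrC.
Qed.

(** The translates by integers have disjoint supports, so at most one term is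
    nonzero. *)
Lemma sum_bump_le e m k (u B : R) : (m < e)%N -> 0 <= B ->
  (forall v, `|bump e m v| <= B) ->
  \sum_(j < k) `|bump e m (u - j%:R)| <= B.
Proof.
move=> me B0 hB.
have [/existsP[j0 hj0]|/existsPn no] := boolP [exists j : 'I_k, 0 < u - j%:R < 1]; last first.
  by rewrite big1// => j _; rewrite bump_out ?normr0.
rewrite (bigD1 j0)//= big1 ?addr0// => j jj0; rewrite bump_out ?normr0//.
apply: contra jj0 => hj; apply/eqP/val_inj => /=.
move: hj hj0 => /andP[h1 h2] /andP[h3 h4].
have a1 : (j%:R < j0.+1%:R :> R) by rewrite -natr1; lra.
have a2 : (j0%:R < j.+1%:R :> R) by rewrite -natr1; lra.
by move: a1 a2; rewrite !ltr_nat !ltnS => a1 a2; apply/eqP; rewrite eqn_leq a1 a2.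
Qed.

(** The interpolating function is the sum over the cells of c q times a product
    of rescaled bumps, normalized by their value at the centre. Expanding the
    sum of the products of absolute values as a product of sums shows that the
    number of cells does not enter the bound on its derivatives, and each
    derivative costs a factor k. *)
Lemma grid_interpolation (L K : nat) : exists2 beta : R, 0 < beta &
  forall (k : nat) (gamma : R) (c : {ffun 'I_K -> 'I_k} -> R), (0 < k)%N ->
    (forall q, `|c q| <= beta * gamma / k%:R ^+ L) ->
    exists2 f, smooth_class L gamma f & forall q, f (cell_center q) = c q.
Proof.
pose e := L.+1; have [B B1 hB] := bump_bounded R e.
have B0 : 0 < B by apply: lt_le_trans B1.
pose s : R := ((1 / 4) ^+ e) ^+ K.
have s0 : 0 < s by rewrite !exprn_gt0//; lra.
exists (s / B ^+ K); first by rewrite divr_gt0 ?exprn_gt0.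
move=> k gamma c k0 hc.
have kR : 0 < k%:R :> R by rewrite ltr0n.
pose g (j : 'I_k) m (v : R) := k%:R ^+ m * bump e m (k%:R * v - j%:R).
have hg j m (u : R) : (m < L)%N -> is_derive u 1 (g j m) (g j m.+1 u).
  by move=> mL; exact: is_derive_scaled_bump.
pose T := product_tower g (fun q => c q / s).
exists (T (fun=> 0%N)).
  apply: (@tower_smooth_class _ _ L T).
  - by move=> a x; exact: product_tower_diff.
  - by move=> a i x; exact: product_tower_partial.
  move=> a x aL _; apply: le_trans (ler_norm_sum _ _ _) _.
  (* D bounds the coefficients; D * k^L * B^K = gamma. *)
  pose D := gamma / (k%:R ^+ L * B ^+ K).
  have hD q : `|c q / s| <= D.
    rewrite normrM normfV (gtr0_norm s0) ler_pdivrMr//; apply: le_trans (hc q) _.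
    rewrite le_eqVlt; apply/orP; left; apply/eqP; rewrite /D.
    by field; rewrite !expf_neq0 ?gt_eqF.
  apply: (@le_trans _ _ (\sum_(q : {ffun 'I_K -> 'I_k}) D *
      (\prod_i `|g (q i) (a i) (x ord0 i)|))).
    by apply: ler_sum => q _; rewrite normrM normr_prod ler_wpM2r// prodr_ge0.
  have D0 : 0 <= D by apply: le_trans (hD [ffun=> Ordinal k0]).
  rewrite -mulr_sumr -(bigA_distr_bigA (fun i j => `|g j (a i) (x ord0 i)|)).
  apply: (@le_trans _ _ (D * \prod_(i < K) (k%:R ^+ a i * B))).
    apply: ler_wpM2l => //; apply: ler_prod => i _.
    rewrite sumr_ge0//=.
    have ae : (a i < e)%N by rewrite ltnS -aL (bigD1 i)//= leq_addr.
    have := sum_bump_le k (k%:R * x ord0 i) ae (ltW B0) (fun v => hB _ v ae).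
    move=> /(ler_wpM2l (exprn_ge0 (a i) (ltW kR))); apply: le_trans.
    rewrite mulr_sumr; apply: ler_sum => j _.
    by rewrite /g normrM (ger0_norm (exprn_ge0 _ (ltW kR))).
  rewrite big_split /= prodrXr aL prodr_const card_ord /D.
  by rewrite divfK// mulf_neq0 ?expf_neq0 ?gt_eqF.
move=> q; rewrite /T /product_tower (bigD1 q)//= [X in _ + X]big1 ?addr0.
  rewrite (eq_bigr (fun=> (1 / 4) ^+ e)); last first.
    move=> i _; rewrite /g mxE expr0 mul1r -bump_half; congr bump.
    by field; rewrite gt_eqF.
  by rewrite prodr_const card_ord divfK ?gt_eqF.
move=> q' q'q; have [i qi] : exists i, q' i != q i.
  apply/existsP; apply: contraR q'q => /existsPn h; apply/eqP/ffunP => i.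
  by apply/eqP; have := h i; rewrite negbK.
rewrite (bigD1 i)//= /g bump_out ?mulr0 ?mul0r ?mulr0//.
rewrite mxE mulrC divfK ?gt_eqF//; apply/negP => /andP[h1 h2].
have a1 : ((q' i)%:R < (q i).+1%:R :> R) by rewrite -natr1; lra.
have a2 : ((q i)%:R < (q' i).+1%:R :> R) by rewrite -natr1; lra.
move: a1 a2; rewrite !ltr_nat !ltnS => a1 a2.
by move/negP: qi; apply; apply/eqP/val_inj/eqP; rewrite eqn_leq a1 a2.
Qed.

End GridInterpolation.

(** * Size of the grid *)

Section GridSize.
Context (R : realType).

Lemma expR1_le4 : expR 1 <= 4 :> R.
Proof.
have h : expR (- (1 / 2)) >= 1 / 2 :> R by have := expR_ge1Dx (- (1 / 2) : R); lra.
have h2 : expR (1 / 2) <= 2 :> R.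
  by rewrite -[1 / 2]opprK expRN invf_ple ?posrE ?expR_gt0//; lra.
have -> : 1 = 1 / 2 + 1 / 2 :> R by lra.
by rewrite expRD; have := expR_ge0 (1 / 2 : R); nra.
Qed.

(** The side of the grid is S = (N/m)^(1/(2L+K)) rounded up to an integer k, so that
    S <= k <= 2S since S >= 1. The factor 0.48 < 1/2 leaves room for this
    rounding in k^K <= n; the last two bounds are S <= k and k <= 2S. *)
Lemma grid_size (L K n m N : nat) : (0 < K)%N -> (0 < m)%N -> (0 < N)%N ->
  m%:R <= N%:R :> R ->
  N%:R <= (48 / 100) ^+ (2 * L + K) * m%:R * n%:R `^ ((2 * L + K)%:R / K%:R) :> R ->
  exists k : nat, [/\ (0 < k)%N, (k ^ K <= n)%N,
    N%:R <= m%:R * k%:R ^+ (2 * L + K) :> R &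
    (m%:R / N%:R) `^ ((2 * L)%:R / (2 * L + K)%:R) <= 4 ^+ L / k%:R ^+ (2 * L) :> R].
Proof.
move=> K0 m0 N0 mN Nle; set d := (2 * L + K)%N in Nle *.
have d0 : (0 < d)%N by rewrite addn_gt0 K0 orbT.
have mR : 0 < m%:R :> R by rewrite ltr0n.
have NR : 0 < N%:R :> R by rewrite ltr0n.
have dR : d%:R != 0 :> R by rewrite pnatr_eq0 -lt0n.
have KR : K%:R != 0 :> R by rewrite pnatr_eq0 -lt0n.
pose S : R := (N%:R / m%:R) `^ (d%:R^-1).
have S0 : 0 < S by rewrite powR_gt0// divr_gt0.
have Sd : S ^+ d = N%:R / m%:R.
  by rewrite -powR_mulrn ?(ltW S0)// -powRrM mulVf// powRr1//.
have S1 : 1 <= S.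
  rewrite -(@ler_pXn2r _ d)// ?nnegrE ?ler01 ?(ltW S0)//.
  by rewrite Sd expr1n ler_pdivlMr// mul1r.
pose nu : R := n%:R `^ (K%:R^-1).
have nu0 : 0 <= nu by exact: powR_ge0.
have nuK : nu ^+ K = n%:R.
  by rewrite -powR_mulrn// -powRrM mulVf// powRr1// ler0n.
have nud : n%:R `^ (d%:R / K%:R) = nu ^+ d.
  by rewrite mulrC powRrM powR_mulrn.
have Snu : S <= 48 / 100 * nu.
  rewrite -(@ler_pXn2r _ d)// ?nnegrE ?(ltW S0)//; last by rewrite mulr_ge0//; lra.
  rewrite exprMn Sd ler_pdivrMr//; apply: le_trans Nle _.
  by rewrite nud mulrAC.
pose k := (Num.truncn S).+1.
have [k1 k2] : S <= k%:R /\ k%:R <= 2 * S.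
  have /andP[h1 h2] := truncn_itv (ltW S0).
  by rewrite /k; split; [exact: ltW | rewrite -natr1; lra].
have kR : 0 < k%:R :> R by rewrite ltr0n.
exists k; split => //.
- rewrite -(ler_nat R) natrX -nuK; apply: lerXn2r; rewrite ?nnegrE ?(ltW kR)//.
  by lra.
- have : S ^+ d <= k%:R ^+ d by apply: lerXn2r; rewrite ?nnegrE ?(ltW kR) ?(ltW S0).
  by rewrite Sd ler_pdivrMr// mulrC.
have -> : m%:R / N%:R = (S^-1) `^ d%:R.
  by rewrite powR_mulrn ?invr_ge0 ?(ltW S0)// exprVn Sd invf_div.
rewrite -powRrM mulrCA mulfV// mulr1 powR_mulrn ?invr_ge0 ?(ltW S0)//.
have -> : 4 ^+ L / k%:R ^+ (2 * L) = (2 / k%:R) ^+ (2 * L) :> R.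
  rewrite expr_div_n (exprM 2); congr (_ ^+ _ / _).
  by rewrite expr2 -natrM.
apply: lerXn2r; rewrite ?nnegrE ?invr_ge0 ?divr_ge0 ?(ltW kR) ?(ltW S0)//.
by rewrite ler_pdivlMr// mulrC ler_pdivrMr.
Qed.

End GridSize.

(** * From estimation to testing *)

Section Reduction.
Context (R : realType).

Lemma chi2_dom_le d (T : measurableType d) (P Q : probability T R) (C C' : R) :
  C <= C' -> chi2_dom P Q C -> chi2_dom P Q C'.
Proof.
move=> CC h f uf; apply: le_trans (h f uf) _; apply: ler_wpM2r => //.
by case/andP: (unit_valued_Rintegral Q (unit_valued_sqr uf)).
Qed.

Lemma frob_norm_sqr n p (X : 'M[R]_(n, p)) :
  frob_norm X ^+ 2 = \sum_i \sum_j X i j ^+ 2.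
Proof.
rewrite sqr_sqrtr// sumr_ge0// => i _; rewrite sumr_ge0// => j _.
exact: sqr_ge0.
Qed.

Lemma measurable_frob_norm_sub d (T : measurableType d) n p
    (Mhat : T -> borelM R n p) (M : 'M[R]_(n, p)) :
  measurable_fun setT Mhat ->
  measurable_fun setT (fun z => frob_norm (Mhat z - M) ^+ 2).
Proof.
move=> mMhat.
rewrite (_ : (fun z => _) =
    fun z => \sum_(i < n) \sum_(j < p) (Mhat z i j - M i j) ^+ 2); last first.
  apply/funext => z; rewrite frob_norm_sqr; apply: eq_bigr => i _.
  by apply: eq_bigr => j _; rewrite !mxE.
apply: measurable_sum => i; apply: measurable_sum => j.
apply: measurable_funX; apply: measurable_funB => //.
exact: (measurableT_comp (measurable_coord i j) mMhat).
Qed.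

Variables (n p : nat) (n_gt0 : (0 < n)%N) (p_gt0 : (0 < p)%N).
Variables (G : finType) (q : 'I_n -> G).

Local Notation word := {ffun G * 'I_p -> 'I_(32 ^ 2)}.

Definition word_mx (delta : R) (w : word) : 'M[R]_(n, p) :=
  \matrix_(i, j) (delta * (w (q i, j))%:R).

(** By the parallelogram inequality the two matrices are at a squared distance
    at most 4 n p b, while each differing letter contributes at least delta^2
    for each of the at least n / (2 #|G|) rows of its cell. *)
Lemma word_mx_separated (delta b : R) (X : 'M[R]_(n, p)) (w w' : word) :
  0 < delta -> (0 < #|G|)%N ->
  (forall F : G -> R, (forall g, 0 <= F g) ->
    n%:R / (2 * #|G|%:R) * \sum_g F g <= \sum_i F (q i)) ->
  b <= delta ^+ 2 / 16 ->
  (n * p)%:R^-1 * frob_norm (X - word_mx delta w) ^+ 2 <= b ->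
  (n * p)%:R^-1 * frob_norm (X - word_mx delta w') ^+ 2 <= b ->
  (2 * #|[pred x | w x != w' x]| <= #|{: G * 'I_p}|)%N.
Proof.
move=> delta0 G0 hq hb h1 h2.
have np0 : 0 < (n * p)%:R :> R by rewrite ltr0n muln_gt0 n_gt0.
have GR : 0 < #|G|%:R :> R by rewrite ltr0n.
have nR : 0 < n%:R :> R by rewrite ltr0n.
pose ne x : R := (w x != w' x)%:R.
have far : n%:R / (2 * #|G|%:R) * \sum_g \sum_(j < p) ne (g, j) * delta ^+ 2 <=
    2 * frob_norm (X - word_mx delta w) ^+ 2 +
    2 * frob_norm (X - word_mx delta w') ^+ 2.
  apply: le_trans (hq (fun g => \sum_(j < p) ne (g, j) * delta ^+ 2) _) _.
    by move=> g; rewrite sumr_ge0// => j _; rewrite mulr_ge0 ?sqr_ge0 ?ler0n.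
  rewrite !frob_norm_sqr !mulr_sumr -big_split /=; apply: ler_sum => i _.
  rewrite !mulr_sumr -big_split /=; apply: ler_sum => j _.
  rewrite !mxE /ne; have [_|ww] := eqVneq (w (q i, j)) (w' (q i, j)).
    by rewrite mul0r; apply: addr_ge0; apply: mulr_ge0 => //; exact: sqr_ge0.
  have gap : 1 <= ((w (q i, j))%:R - (w' (q i, j))%:R : R) ^+ 2.
    have : (w (q i, j) != w' (q i, j) :> nat) by [].
    by rewrite neq_ltn => /orP[]; rewrite -(ler_nat R) -natr1; nra.
  rewrite mul1r; move: gap.
  set a := (w _)%:R; set a' := (w' _)%:R; set x := X i j => gap.
  have : 0 <= (2 * x - delta * a - delta * a') ^+ 2 by exact: sqr_ge0.
  have : delta ^+ 2 * 1 <= delta ^+ 2 * (a - a') ^+ 2.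
    by apply: ler_wpM2l => //; exact: sqr_ge0.
  by rewrite !expr2; nra.
have npb (Y : 'M[R]_(n, p)) : (n * p)%:R^-1 * frob_norm Y ^+ 2 <= b ->
    frob_norm Y ^+ 2 <= (n * p)%:R * (delta ^+ 2 / 16).
  by rewrite ler_pdivrMl// => h; apply: le_trans h _; apply: ler_wpM2l => //.
have : \sum_g \sum_(j < p) ne (g, j) * delta ^+ 2 =
    #|[pred x | w x != w' x]|%:R * delta ^+ 2.
  rewrite pair_big /= -mulr_suml; congr (_ * _).
  rewrite -sum1_card natr_sum [RHS]big_mkcond /=; apply: eq_bigr => -[g j] _.
  by rewrite /ne inE; case: (_ != _).
move=> E; move: far; rewrite E => far.
have far2 := le_trans far (lerD (ler_wpM2l (ler0n _ 2) (npb _ h1))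
                                (ler_wpM2l (ler0n _ 2) (npb _ h2))).
rewrite card_prod card_ord -(ler_nat R) !natrM; move: far2; rewrite natrM.
have d2 : 0 < delta ^+ 2 by rewrite exprn_gt0.
rewrite mulrAC ler_pdivrMr ?mulr_gt0//.
set H := #|[pred x | w x != w' x]|%:R; set gR := #|G|%:R.
move=> far2.
have : (n%:R * delta ^+ 2) * (2 * H) <= (n%:R * delta ^+ 2) * (gR * p%:R) by lra.
by rewrite ler_pM2l// mulr_gt0.
Qed.

Lemma word_mx_testing (sigma delta b : R) (N : nat)
    (Mhat : N.-tuple (measurableTypeR R * borelM R n p)%type -> borelM R n p) :
  sigma != 0 -> 0 < delta -> (0 < #|G|)%N ->
  (forall F : G -> R, (forall g, 0 <= F g) ->
    n%:R / (2 * #|G|%:R) * \sum_g F g <= \sum_i F (q i)) ->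
  N%:R * (1024 * delta) ^+ 2 / sigma ^+ 2 <= (#|G| * p)%:R ->
  b <= delta ^+ 2 / 16 ->
  measurable_fun setT Mhat ->
  exists w, ((2^-1)%:E <= sample_law n_gt0 p_gt0 sigma (word_mx delta w) N
    [set z | (b < (n * p)%:R^-1 * frob_norm (Mhat z - word_mx delta w) ^+ 2)%R])%E.
Proof.
move=> s0 delta0 G0 hq hN hb mMhat.
pose E w := [set z | (n * p)%:R^-1 * frob_norm (Mhat z - word_mx delta w) ^+ 2 <= b].
have mE w : measurable (E w).
  have mf : measurable_fun setT
      (fun z => (n * p)%:R^-1 * frob_norm (Mhat z - word_mx delta w) ^+ 2).
    by apply: measurable_funM => //; exact: measurable_frob_norm_sub.
  rewrite -[E w]setTI.
  by have := mf measurableT _ (measurable_itv `]-oo, b]).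
pose D := #|{: G * 'I_p}|.
have DE : D = (#|G| * p)%N by rewrite /D card_prod card_ord.
have D0 : (0 < D)%N by rewrite DE muln_gt0 G0.
have [w hw] : exists w : word,
    (sample_law n_gt0 p_gt0 sigma (word_mx delta w) N (E w) <= (2^-1)%:E)%E.
  apply: (@chi2_testing _ _ _ _ _ (sample_law n_gt0 p_gt0 sigma 0 N) E
            (4 ^+ D) ((2 * 32) ^ D)%:R).
  - by apply/card_gt0P; exists [ffun=> ord0].
  - exact: exprn_ge0.
  - exact: mE.
  - move=> w; apply: (@chi2_dom_le _ _ _ _
      (expR (N%:R * (1024 * delta) ^+ 2 / sigma ^+ 2))); last first.
      apply: chi2_dom_sample_law => // i j; rewrite mxE.
      rewrite ger0_norm ?mulr_ge0 ?(ltW delta0)// mulrC ler_wpM2r ?(ltW delta0)//.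
      by rewrite ler_nat; apply: ltnW; exact: (ltn_ord (w (q i, j))).
    apply: (@le_trans _ _ (expR (D%:R * 1))).
      by rewrite ler_expR mulr1 DE.
    by rewrite expRM_natl lerXn2r ?nnegrE ?expR_ge0// expR1_le4.
  - move=> z; rewrite ler_nat.
    pose S := finset (fun w : word => `[< E w z >]).
    have -> : #|[pred w | `[< E w z >]]| = #|S|.
      by apply: eq_card => w; rewrite /S !inE.
    apply: card_hamming_cluster => // w w'; rewrite /S !inE.
    move=> h h'; exact: (word_mx_separated delta0 G0 hq hb h h').
  rewrite card_ffun card_ord -[4]/(4%:R) -!natrX -!natrM ler_nat.
  have -> : ((32 ^ 2) ^ D = 4 ^ D * 4 ^ D * (2 * 32) ^ D)%N by rewrite -!expnMn.
  by rewrite !leq_pmul2r ?expn_gt0// -{1}[4%N]expn1 leq_exp2l.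
exists w.
have -> : [set z | b < (n * p)%:R^-1 * frob_norm (Mhat z - word_mx delta w) ^+ 2] =
    ~` E w.
  by apply/seteqP; split => z /=; rewrite /E /= ltNge => /negP.
rewrite probability_setC//.
have h2 : (2^-1)%:E = (1 - (2^-1)%:E)%E :> \bar R.
  by rewrite -EFinB; congr EFin; lra.
by rewrite [leLHS]h2 leeB.
Qed.

End Reduction.

(** * The lower bound *)

Unset Implicit Arguments.

Theorem theorem3 (R : realType) (L K : nat) (gamma sigma kappa : R) :
  (1 <= L)%N -> (1 <= K)%N -> 0 < gamma -> 0 < sigma -> 0 < kappa ->
  exists A c0 : R, [/\ 0 < A, 0 < c0 &
    forall (n p N : nat) (n_gt0 : (0 < n)%N) (p_gt0 : (0 < p)%N),
    (0 < N)%N ->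
    n%:R / p%:R = kappa ->
    c0 `^ (- ((2 * L + K)%:R / K%:R)) * (maxn n p)%:R <= N%:R ->
    N%:R <= c0 `^ (- ((2 * L + K)%:R / K%:R)) * (48 / 100) ^+ (2 * L + K)
              * (maxn n p)%:R * n%:R `^ ((2 * L + K)%:R / K%:R) ->
    ((2^-1)%:E <= ereal_inf
      [set ereal_sup
        [set sample_law n_gt0 p_gt0 sigma M N
          [set z | (A * ((maxn n p)%:R / N%:R) `^ ((2 * L)%:R / (2 * L + K)%:R)
                   < (n * p)%:R^-1 * frob_norm (Mhat z - M) ^+ 2)%R]
        | M in @matrix_class R K n p L gamma]
      | Mhat in [set Mhat : N.-tuple (measurableTypeR R * borelM R n p)%type ->
                            borelM R n p | measurable_fun [set: _] Mhat]])%E].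
Proof.
move=> L1 K1 gamma0 sigma0 kappa0.
have [beta beta0 interp] := grid_interpolation R L K.
have k10 : 0 < kappa + 1 by rewrite addr_gt0.
(* The two bounds on tau serve smoothness and indistinguishability; 1024 bounds
   the letters. *)
have [tau [tau0 tau1 tau2]] : exists tau : R, [/\ 0 < tau,
    tau * 1024 <= beta * gamma & tau * 1024 <= sigma / (kappa + 1)].
  exists (Num.min (beta * gamma) (sigma / (kappa + 1)) / 1024).
  have c1024 : (1024 : R) != 0 by rewrite pnatr_eq0.
  rewrite (divfK c1024); split; first last.
  - by rewrite ge_min lexx orbT.
  - by rewrite ge_min lexx.
  apply: divr_gt0; last by rewrite ltr0n.
  by rewrite lt_min mulr_gt0 ?divr_gt0.
have c1024_ge0 : 0 <= 1024 :> R by exact: ler0n.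
have A0 : 0 < tau ^+ 2 / (16 * 4 ^+ L).
  apply: divr_gt0; first exact: exprn_gt0.
  by apply: mulr_gt0; [rewrite ltr0n | apply: exprn_gt0; rewrite ltr0n].
exists (tau ^+ 2 / (16 * 4 ^+ L)), 1; split => //.
move=> n p N n0 p0 N0 npk; rewrite powR1 !mul1r => Nge Nle.
have pR : 0 < p%:R :> R by rewrite ltr0n.
have m0 : (0 < maxn n p)%N by rewrite leq_max n0.
have [k [k0 kn Nk rate]] := grid_size K1 m0 N0 Nge Nle.
have kR : 0 < k%:R :> R by rewrite ltr0n.
pose G : finType := {ffun 'I_K -> 'I_k}.
have GE : #|G| = (k ^ K)%N by rewrite card_ffun !card_ord.
have G0 : (0 < #|G|)%N by rewrite GE expn_gt0 k0.
have Gn : (0 < #|G| <= n)%N by rewrite G0 GE.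
have [q hq] := balanced_assignment R Gn.
pose delta := tau / k%:R ^+ L.
have delta0 : 0 < delta by rewrite divr_gt0// exprn_gt0.
apply: le_ereal_inf_tmp => _ [Mhat mMhat <-].
pose b := tau ^+ 2 / (16 * 4 ^+ L) *
  ((maxn n p)%:R / N%:R) `^ ((2 * L)%:R / (2 * L + K)%:R).
(* The rate is at most (2 / k)^(2L), whence the factor 4^L in A. *)
have hb : b <= delta ^+ 2 / 16.
  rewrite /b /delta expr_div_n -exprM (mulnC L).
  apply: (@le_trans _ _ (tau ^+ 2 / (16 * 4 ^+ L) * (4 ^+ L / k%:R ^+ (2 * L)))).
    by apply: ler_wpM2l; [exact: ltW A0 | exact: rate].
  rewrite le_eqVlt; apply/orP; left; apply/eqP.
  have c4 : (4 : R) ^+ L != 0 by rewrite expf_neq0// pnatr_eq0.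
  have ck : k%:R ^+ (2 * L) != 0 :> R by rewrite expf_neq0// gt_eqF.
  by field; rewrite c4 ck.
(* The chi-square exponent is at most the length of the words: N <= max(n, p) * k^(2L+K) makes
   N * delta^2 <= tau^2 * max(n, p) * k^K, and max(n, p) <= (kappa + 1) * p. *)
have hN c : 0 <= c -> tau * c <= sigma / (kappa + 1) ->
    N%:R * (c * delta) ^+ 2 / sigma ^+ 2 <= (#|G| * p)%:R.
  move=> c0 tauc.
  have mp : (maxn n p)%:R <= (kappa + 1) * p%:R :> R.
    have nE : n%:R = kappa * p%:R :> R by rewrite -npk divfK ?gt_eqF.
    by rewrite mulrDl mul1r -nE -natrD ler_nat geq_max leq_addr leq_addl.
  rewrite ler_pdivrMr ?exprn_gt0//.
  apply: (@le_trans _ _ ((maxn n p)%:R * k%:R ^+ (2 * L + K) * (c * delta) ^+ 2)).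
    by apply: ler_wpM2r => //; exact: sqr_ge0.
  have -> : (maxn n p)%:R * k%:R ^+ (2 * L + K) * (c * delta) ^+ 2 =
      (tau * c) ^+ 2 * ((maxn n p)%:R * k%:R ^+ K) :> R.
    by rewrite /delta exprD mulnC exprM; field; rewrite expf_neq0// gt_eqF.
  have t2 : (tau * c) ^+ 2 * (kappa + 1) <= sigma ^+ 2.
    have a0 : 0 <= tau * c by rewrite mulr_ge0 ?c0 ?(ltW tau0).
    move: tauc; rewrite ler_pdivlMr// => tauc.
    have tauc' : tau * c <= sigma.
      by apply: le_trans tauc; rewrite ler_peMr// lerDr ltW.
    by rewrite expr2 -mulrA expr2; apply: ler_pM => //; rewrite mulr_ge0// ltW.
  rewrite GE natrM natrX.
  apply: (@le_trans _ _ ((tau * c) ^+ 2 * ((kappa + 1) * p%:R * k%:R ^+ K))).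
    apply: ler_wpM2l; first exact: sqr_ge0.
    by apply: ler_wpM2r => //; exact: exprn_ge0.
  have -> : (tau * c) ^+ 2 * ((kappa + 1) * p%:R * k%:R ^+ K) =
      k%:R ^+ K * p%:R * ((tau * c) ^+ 2 * (kappa + 1)) by ring.
  by apply: ler_wpM2l => //; rewrite mulr_ge0 ?exprn_ge0.
have [w hw] := word_mx_testing n0 p0 (lt0r_neq0 sigma0) delta0 G0 hq
  (hN _ c1024_ge0 tau2) hb mMhat.
apply: le_trans hw _; apply: ereal_sup_ubound; exists (word_mx q delta w) => //.
have fE j : exists f : 'rV[R]_K -> R, smooth_class L gamma f /\
    forall g : G, f (cell_center R g) = delta * (w (g, j))%:R.
  have small (g : G) : `|delta * (w (g, j))%:R| <= beta * gamma / k%:R ^+ L.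
    rewrite (ger0_norm (mulr_ge0 (ltW delta0) (ler0n _ _))).
    apply: (@le_trans _ _ (delta * 1024)).
      rewrite ler_wpM2l ?(ltW delta0)// ler_nat.
      by apply: ltnW; exact: (ltn_ord (w (g, j))).
    rewrite /delta mulrAC; apply: ler_wpM2r; last exact: tau1.
    by rewrite invr_ge0 exprn_ge0.
  by have [f sf fw] := interp k gamma _ k0 small; exists f.
have [f hf] := choice fE.
exists f, (fun i => cell_center R (q i)); split.
- by move=> j; case: (hf j).
- by move=> i; exact: cell_center_cube.
- by move=> i j; rewrite mxE (hf j).2.
Qed.
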